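(* Let $d\le n$ and $k\le n$ be positive integers, let $\bm a_1,\dots,\bm a_n\in\mathbb{R}^d$, let $\lambda>0$, let $\bm A\in\mathbb{R}^{d\times n}$ be the matrix whose columns are $\bm a_1,\dots,\bm a_n$, and let $\bm C:=\bm A^{\top}\bm A+\lambda\bm I_n$. Then the problem $$z_k:=\min_{S\subseteq [n]}\left\{\operatorname{tr}\left(\left(\sum_{i\in S}\bm a_i\bm a_i^{\top}+\lambda \bm I_d\right)^{-1}\right): |S|=k\right\}$$ can be converted into the following problem: $$z_k=\min_{S\subseteq [n]}\left\{\operatorname{tr}\left(\left(\bm C_{S,S}\right)^{-1}\right)+\frac{d-k}{\lambda}: |S|=k\right\}.$$
   Context: $[n]=\{1,\dots,n\}$; $\bm I_m$ is the $m\times m$ identity matrix; for $S\subseteq[n]$, $\bm C_{S,S}$ is the principal submatrix of $\bm C$ with rows and columns indexed by $S$. *)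

(* Defs.v *)
From HB Require Import structures.
From mathcomp Require Import all_boot all_order all_algebra.
From mathcomp Require Import reals.

Set Implicit Arguments.
Unset Strict Implicit.
Unset Printing Implicit Defensive.

Import Order.TTheory GRing.Theory Num.Theory.
Local Open Scope ring_scope.

(* For k <= n the seed [set i | i < k] of the arg min is feasible, so this is
   the genuine minimum (min_card_attained, min_card_le); for k > n there is no
   feasible set and the value is a junk one. *)
Definition min_card (R : realFieldType) (n k : nat) (f : {set 'I_n} -> R) : R :=
  f [arg min_(S < [set i : 'I_n | (i < k)%N] | #|S| == k) f S]%O.

(* enum_val lists S in increasing order. *)
Definition princ_submx (R : realFieldType) (n : nat) (M : 'M[R]_n)
    (S : {set 'I_n}) : 'M[R]_#|S| :=
  mxsub (fun i : 'I_#|S| => enum_val i) (fun i : 'I_#|S| => enum_val i) M.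

Definition cols_mx (R : realFieldType) (d n : nat) (a : 'I_n -> 'cV[R]_d) :
  'M[R]_(d, n) := \matrix_(i < d, j < n) a j i 0.

Definition reg_gram (R : realFieldType) (d n : nat) (a : 'I_n -> 'cV[R]_d)
    (lambda : R) : 'M[R]_n :=
  (cols_mx a)^T *m cols_mx a + lambda *: 1%:M.

Definition z_opt (R : realFieldType) (d n : nat) (a : 'I_n -> 'cV[R]_d)
    (lambda : R) (k : nat) : R :=
  min_card k (fun S : {set 'I_n} =>
    \tr (invmx ((\sum_(i in S) a i *m (a i)^T) + lambda *: 1%:M))).

Lemma card_ord_lt (n k : nat) :
  (k <= n)%N -> #|[set i : 'I_n | (i < k)%N]| == k.
Proof.
move=> le_kn; rewrite -[X in _ == X]card_ord.
have inj_w : injective (widen_ord le_kn).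
  by move=> i j /(congr1 val)/= eq_ij; apply: val_inj.
rewrite -(card_imset _ inj_w); apply/eqP/eq_card => i; rewrite inE.
apply/idP/imsetP => [lt_ik | [j _ ->]]; last exact: (ltn_ord j).
by exists (Ordinal lt_ik) => //; apply: val_inj.
Qed.

Lemma min_card_attained (R : realFieldType) (n k : nat)
    (f : {set 'I_n} -> R) : (k <= n)%N ->
  exists2 S : {set 'I_n}, #|S| = k & min_card k f = f S.
Proof.
move=> le_kn; rewrite /min_card.
by case: arg_minP => [|S /eqP cS _]; [exact: card_ord_lt | exists S].
Qed.

Lemma min_card_le (R : realFieldType) (n k : nat) (f : {set 'I_n} -> R)
    (S : {set 'I_n}) : (k <= n)%N -> #|S| = k -> min_card k f <= f S.
Proof.
move=> le_kn cS; rewrite /min_card.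
case: arg_minP => [|S' _ minS']; first exact: card_ord_lt.
by apply: minS'; apply/eqP.
Qed.

(* Main.v *)
Require Import Defs.
From mathcomp Require Import all_boot all_order all_algebra.
From mathcomp Require Import reals.
From mathcomp Require Import lra.

Set Implicit Arguments.
Unset Strict Implicit.
Unset Printing Implicit Defensive.

Import Order.TTheory GRing.Theory Num.Theory.
Local Open Scope ring_scope.

(* Let B be the d x k matrix whose columns are the a_i with i in S. With
   M = B B^T + lambda I_d and N = B^T B + lambda I_k we have M B = B N, so
   M^-1 B = B N^-1, and cyclicity of the trace gives
     d - lambda tr M^-1 = tr (M^-1 B B^T) = tr (N^-1 B^T B)
                        = k - lambda tr N^-1.
   Hence the two objectives agree on every feasible S. *)

(** Since [k <= n], each minimum is attained at a set of size [k]; there the other objective takes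
    the same value, so each minimum bounds the other. *)
Lemma eq_min_card (R : realFieldType) (n k : nat) (f g : {set 'I_n} -> R) :
    (k <= n)%N -> (forall S : {set 'I_n}, #|S| = k -> f S = g S) ->
  min_card k f = min_card k g.
Proof.
move=> le_kn eq_fg; apply/le_anti/andP; split.
  have [S cS ->] := min_card_attained g le_kn.
  by rewrite -eq_fg // min_card_le.
have [S cS ->] := min_card_attained f le_kn.
by rewrite eq_fg // min_card_le.
Qed.

Lemma row_dotmx_ge0 (R : realFieldType) (n : nat) (v : 'rV[R]_n) :
  0 <= (v *m v^T) 0 0.
Proof. by rewrite mxE sumr_ge0 // => i _; rewrite mxE -expr2 sqr_ge0. Qed.

Lemma row_dotmx_eq0 (R : realFieldType) (n : nat) (v : 'rV[R]_n) :
  (v *m v^T) 0 0 = 0 -> v = 0.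
Proof.
rewrite mxE => /eqP; rewrite psumr_eq0 => [/allP v0|i _]; last first.
  by rewrite mxE -expr2 sqr_ge0.
apply/rowP => i; have := v0 i; rewrite mem_index_enum => /(_ isT).
by rewrite !mxE mulf_eq0 orbb => /eqP.
Qed.

(** A row [v] in the left kernel satisfies |vB|^2 + lambda |v|^2 = 0. Both terms are nonnegative and
    [lambda] is positive, so [v] vanishes. *)
Lemma gram_add_scalar_unit (R : realFieldType) (m p : nat) (B : 'M[R]_(m, p))
    (lambda : R) : 0 < lambda -> B *m B^T + lambda *: 1%:M \in unitmx.
Proof.
move=> lambda_gt0; rewrite -row_free_unit -kermx_eq0.
apply/eqP/row_matrixP => i; rewrite row0.
set v := row i _.
have : v *m (B *m B^T + lambda *: 1%:M) = 0.
  by rewrite /v -row_mul mulmx_ker row0.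
move/(congr1 (fun w => (w *m v^T) 0 0)).
have -> : v *m (B *m B^T + lambda *: 1%:M) *m v^T =
    (v *m B) *m (v *m B)^T + lambda *: (v *m v^T).
  by rewrite mulmxDr mulmxDl trmx_mul !mulmxA -scalemxAr mulmx1 -scalemxAl.
rewrite mul0mx [LHS]mxE [X in _ + X]mxE [RHS]mxE => /eqP.
rewrite paddr_eq0 ?row_dotmx_ge0 ?pmulr_rge0 ?row_dotmx_ge0 //.
case/andP=> _; rewrite mulf_eq0 gt_eqF //= => /eqP.
exact: row_dotmx_eq0.
Qed.

Lemma trace_invmx_gram (R : realFieldType) (m p : nat) (B : 'M[R]_(m, p))
    (lambda : R) : 0 < lambda ->
  \tr (invmx (B *m B^T + lambda *: 1%:M)) =
  \tr (invmx (B^T *m B + lambda *: 1%:M)) + (m%:R - p%:R) / lambda.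
Proof.
move=> lambda_gt0; have lambda_neq0 := lt0r_neq0 lambda_gt0.
have unitM := gram_add_scalar_unit B lambda_gt0.
have unitN := gram_add_scalar_unit B^T lambda_gt0; rewrite trmxK in unitN.
set M := B *m B^T + _ in unitM *; set N := B^T *m B + _ in unitN *.
have MB : M *m B = B *m N.
  by rewrite mulmxDl mulmxDr mulmxA -scalemxAl -scalemxAr mul1mx mulmx1.
(* Insert N N^-1 on the right, then turn B N into M B so that M^-1 cancels. *)
have invMB : invmx M *m B = B *m invmx N.
  by rewrite -[LHS](mulmxK unitN) -[_ *m B *m N]mulmxA -MB mulKmx.
have trM : \tr (invmx M *m (B *m B^T)) = m%:R - lambda * \tr (invmx M).
  have -> : B *m B^T = M - lambda *: 1%:M by rewrite addrK.
  by rewrite mulmxBr mulVmx // -scalemxAr mulmx1 raddfB /= mxtraceZ mxtrace1.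
have trN : \tr (invmx N *m (B^T *m B)) = p%:R - lambda * \tr (invmx N).
  have -> : B^T *m B = N - lambda *: 1%:M by rewrite addrK.
  by rewrite mulmxBr mulVmx // -scalemxAr mulmx1 raddfB /= mxtraceZ mxtrace1.
have : m%:R - lambda * \tr (invmx M) = p%:R - lambda * \tr (invmx N).
  by rewrite -trM -trN mulmxA invMB mxtrace_mulC mulmxA mxtrace_mulC.
(* Multiplying by [lambda] clears the division and leaves a goal linear in m, p and the products of
   [lambda] with the two traces. *)
move=> eqMN; apply: (mulfI lambda_neq0).
rewrite mulrDr [lambda * (_ / _)]mulrC divfK //.
lra.
Qed.

(** [B] lists its columns by [enum_val], as [princ_submx] does, so the same [B] serves both
    objectives without any permutation. *)
Lemma sum_outer_colsub (R : realFieldType) (d n : nat) (a : 'I_n -> 'cV[R]_d)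
    (S : {set 'I_n}) (B := colsub (@enum_val _ (mem S)) (cols_mx a)) :
  \sum_(i in S) a i *m (a i)^T = B *m B^T.
Proof.
apply/matrixP => i j; rewrite summxE mxE big_enum_val; apply: eq_bigr => l _.
by rewrite !mxE big_ord1 !mxE.
Qed.

Lemma princ_submx_reg_gram (R : realFieldType) (d n : nat)
    (a : 'I_n -> 'cV[R]_d) (lambda : R) (S : {set 'I_n})
    (B := colsub (@enum_val _ (mem S)) (cols_mx a)) :
  princ_submx (reg_gram a lambda) S = B^T *m B + lambda *: 1%:M.
Proof.
(* Injectivity of [enum_val] makes the restriction of the identity to S an identity matrix again. *)
apply/matrixP => i j; rewrite !mxE (inj_eq enum_val_inj); congr (_ + _).
by apply: eq_bigr => l _; rewrite !mxE.
Qed.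

Theorem proposition1 (R : realType) (d n k : nat)
    (hd : (0 < d)%N) (hk : (0 < k)%N) (hdn : (d <= n)%N) (hkn : (k <= n)%N)
    (a : 'I_n -> 'cV[R]_d) (lambda : R) (hlambda : 0 < lambda) :
  z_opt a lambda k =
  min_card k (fun S : {set 'I_n} =>
    \tr (invmx (princ_submx (reg_gram a lambda) S))
      + (d%:R - k%:R) / lambda).
Proof.
apply: eq_min_card => // S cardS.
(* Writing [k] as [#|S|] matches it with the number of columns of [B]. *)
by rewrite -cardS sum_outer_colsub princ_submx_reg_gram trace_invmx_gram.
Qed.
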